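(* Let $G$ be a finitely generated group. Suppose that $G$ has a finite index subgroup that possesses an infinite quotient group $\overline{G}$ for which the word problem is solvable in the complexity class $\mathcal{C}$. Then the word problem for $G$ has generic-case complexity in the class $\mathcal{C}$. Moreover, if the group $\overline{G}$ is non-amenable, then the generic-case complexity of the word problem for $G$ is strongly in $\mathcal{C}$.
   Context: Complexity classes. A complexity class $\mathcal{C}$ is specified by the model of computation (always a multi-tape Turing machine), a mode of computation (e.g. deterministic or non-deterministic), the resources to be controlled (time or space or a combination thereof), and, for each controlled resource, a collection of bounding functions $f$: on an input $w$ at most $f(|w|)$ units of the resource may be used. Each collection consists of proper complexity functions $f(n)>0$, and for every $f$ in the collection and every integer $C\ge 1$ the function $n\mapsto Cf(Cn+C)+C$ is also in the collection. (A proper complexity function is a non-decreasing function $f$ for which there is a multi-tape Turing machine which on input $w$ computes the string $1^{f(|w|)}$ in $O(|w|+f(|w|))$ steps and uses $O(f(|w|))$ space besides its input.) Word problem. If $A$ is a finite generating set of a group $G$ (i.e. a finite set with a map $\pi:A\to G$ whose image generates $G$), let $X=A\cup A^{-1}$ ($A^{-1}$ the set of formal inverses), let $X^*$ be the set of all words over $X$, and extend $\pi$ to $X^*\to G$. The word problem with respect to $A$ is the set $WP(G,A)=\{w\in X^* : \pi(w)=1\}$. The word problem for a group is solvable in $\mathcal{C}$ if for every finite generating set $A$ the language $WP(\cdot,A)$ is in $\mathcal{C}$. Genericity. For a finite alphabet $X$ with at least two elements and $S\subseteq X^*$, let $B_n$ be the set of words of length at most $n$ and $\rho_n(S)=|S\cap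 B_n|/|B_n|$. $S$ is generic if $\lim_{n\to\infty}\rho_n(S)=1$, and strongly generic if in addition the convergence is exponentially fast, i.e. there are $0\le\sigma<1$ and $C>0$ with $1-\rho_n(S)\le C\sigma^n$ for all $n\ge1$. Generic-case complexity. Let $\mathcal{D}\subseteq X^*$. A partial algorithm $\Omega$ is correct for $\mathcal{D}$ if whenever it reaches a decision on whether an input belongs to $\mathcal{D}$, that decision is correct. A correct partial algorithm $\Omega$ solves $\mathcal{D}$ with generic-case complexity $\mathcal{C}$ (resp. strongly $\mathcal{C}$) if there is a generic (resp. strongly generic) $S\subseteq X^*$ such that on every input from $S$ the algorithm terminates with a decision within the complexity bound $\mathcal{C}$. The word problem for $G$ has generic-case complexity in $\mathcal{C}$ (strongly in $\mathcal{C}$) if for every finite generating set $A$ of $G$ there is a correct partial algorithm solving $WP(G,A)$ with generic-case complexity $\mathcal{C}$ (strongly $\mathcal{C}$). *)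

(* Defs.v *)
From HB Require Import structures.
From mathcomp Require Import all_boot all_order all_algebra.
From mathcomp Require Import all_classical all_reals all_analysis.
Set Implicit Arguments.
Unset Strict Implicit.
Unset Printing Implicit Defensive.
Import Order.TTheory GRing.Theory Num.Theory.
Import numFieldNormedType.Exports.
Local Open Scope classical_set_scope.

(* The input is on a two-way read-only tape between two end markers, and is not
   counted as space; the k work tapes are infinite in both directions. *)

Inductive input_symbol (X : Type) := LeftEnd | Letter of X | RightEnd.
Arguments LeftEnd {X}.
Arguments RightEnd {X}.

Inductive move := MoveLeft | Stay | MoveRight.

(* [tleft] is listed from the head outwards. A tape records exactly the cells
   visited so far, whether or not they are blank. *)
Record tape (Gamma : Type) :=
  Tape { tleft : seq Gamma; current : Gamma; tright : seq Gamma }.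

Definition tape_cells Gamma (t : tape Gamma) : seq Gamma :=
  rev (tleft t) ++ current t :: tright t.

Definition move_tape Gamma (blank : Gamma) (m : move) (t : tape Gamma) :=
  match m, t with
  | Stay, _ => t
  | MoveLeft, Tape [::] c r => Tape [::] blank (c :: r)
  | MoveLeft, Tape (x :: l) c r => Tape l x (c :: r)
  | MoveRight, Tape l c [::] => Tape (c :: l) blank [::]
  | MoveRight, Tape l c (x :: r) => Tape (c :: l) x r
  end.

Record action (k : nat) (Q Gamma : Type) := Action {
  next_state : Q;
  input_move : move;
  tape_actions : {ffun 'I_k -> Gamma * move}  (* symbol written, then move *)
}.

(* The verdict of a state only matters when the machine halts in it; [None]
   means halting without a decision, which a partial algorithm may do. *)
Record machine (X : Type) := Machine {
  ntapes : nat;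
  state : finType;
  symbol : finType;
  start : state;
  blank : symbol;
  trans : state -> input_symbol X -> {ffun 'I_ntapes -> symbol} ->
          set (action ntapes state symbol);
  verdict : state -> option bool
}.

Definition deterministic X (M : machine X) :=
  forall q x s, is_subset1 (@trans X M q x s).

Section Runs.
Variables (X : Type) (M : machine X) (w : seq X).

Record config := Config {
  cstate : state M;
  cinput : nat;
  ctapes : {ffun 'I_(ntapes M) -> tape (symbol M)}
}.

Definition init : config :=
  Config (start M) 1 [ffun=> Tape [::] (blank M) [::]].

Definition read_input (p : nat) : input_symbol X :=
  nth RightEnd (LeftEnd :: map (@Letter X) w) p.

Definition move_input (m : move) (p : nat) : nat :=
  match m with
  | MoveLeft => p.-1
  | Stay => p
  | MoveRight => minn p.+1 (size w).+1
  end.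

Definition perform (a : action (ntapes M) (state M) (symbol M)) (c : config) :=
  Config (next_state a) (move_input (input_move a) (cinput c))
    [ffun i => let: Tape l _ r := ctapes c i in
               move_tape (blank M) (tape_actions a i).2
                 (Tape l (tape_actions a i).1 r)].

Definition step (c c' : config) : Prop :=
  exists2 a, trans (cstate c) (read_input (cinput c))
               [ffun i => current (ctapes c i)] a
           & c' = perform a c.

Definition halted (c : config) := forall c', ~ step c c'.

Inductive run : nat -> config -> Prop :=
  | run_init : run 0 init
  | run_step n c c' : run n c -> step c c' -> run n.+1 c'.

Definition terminates :=
  ~ exists c : nat -> config, c 0 = init /\ forall n, step (c n) (c n.+1).

(* For nondeterministic machines: one accepting computation suffices for a
   positive decision; a negative decision requires that all computations halt
   and all of them reject. *)
Definition accepts :=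
  exists n c, [/\ run n c, halted c & verdict (cstate c) = Some true].

Definition rejects := terminates /\
  forall n c, run n c -> halted c -> verdict (cstate c) = Some false.

Definition time_within (t : nat) := forall n c, run n c -> n <= t.

Definition space (c : config) : nat :=
  \sum_(i < ntapes M) size (tape_cells (ctapes c i)).

Definition space_within (s : nat) := forall n c, run n c -> space c <= s.

End Runs.

(* M writes f(|w|) as a block of marks [one] on its work tape [o], the other
   cells of that tape being blank. *)
Definition computes_unary X (M : machine X) (f : nat -> nat) :=
  exists (o : 'I_(ntapes M)) (one : symbol M) (K : nat),
    one != blank M /\
    forall w : seq X,
      space_within M w (K * f (size w)) /\
      exists n c, [/\ run w n c, halted w c, n <= K * (size w + f (size w)) &
        exists i j, tape_cells (ctapes c o) =
          nseq i (blank M) ++ nseq (f (size w)) one ++ nseq j (blank M)].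

Definition proper_complexity (f : nat -> nat) :=
  {homo f : m n / m <= n} /\
  forall X : finType, exists2 M : machine X, deterministic M
                                           & computes_unary M f.

Definition bounding_family (F : set (nat -> nat)) :=
  (forall f, F f -> proper_complexity f /\ forall n, 0 < f n) /\
  (forall f K, F f -> 1 <= K -> F (fun n => K * f (K * n + K) + K)).

Inductive mode := Deterministic | Nondeterministic.

Inductive resources :=
  | Time of set (nat -> nat)
  | Space of set (nat -> nat)
  | TimeSpace of set (nat -> nat) & set (nat -> nat).

Definition admissible (r : resources) :=
  match r with
  | Time F | Space F => bounding_family F
  | TimeSpace F F' => bounding_family F /\ bounding_family F'
  end.

Record complexity_class := ComplexityClass {
  class_mode : mode;
  class_resources : resources;
  class_admissible : admissible class_resources
}.

Definition has_mode (m : mode) X (M : machine X) : Prop :=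
  if m is Deterministic then deterministic M else True.

(* The bounding functions are chosen uniformly in the input w in S. *)
Definition bounded_on (r : resources) X (M : machine X) (S : set (seq X)) :=
  match r with
  | Time F => exists2 f, F f & forall w, S w -> time_within M w (f (size w))
  | Space F => exists2 f, F f & forall w, S w -> space_within M w (f (size w))
  | TimeSpace F F' => exists f f', [/\ F f, F' f' & forall w, S w ->
      time_within M w (f (size w)) /\ space_within M w (f' (size w))]
  end.

Definition correct X (M : machine X) (D : set (seq X)) :=
  forall w, (accepts M w -> D w) /\ (rejects M w -> ~ D w).

Definition decides_on (C : complexity_class) X (M : machine X)
    (S : set (seq X)) :=
  (forall w, S w -> terminates M w /\ (accepts M w \/ rejects M w)) /\
  bounded_on (class_resources C) M S.

Definition in_class (C : complexity_class) (X : finType) (D : set (seq X)) :=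
  exists M : machine X,
    [/\ has_mode (class_mode C) M, correct M D & decides_on C M setT].

Definition ball_count (X : finType) (S : set (seq X)) (n : nat) : nat :=
  \sum_(k < n.+1) #|[pred t : k.-tuple X | `[< S t >]]|.

Definition rho (R : realType) (X : finType) (S : set (seq X)) (n : nat) : R :=
  ((ball_count S n)%:R / (ball_count [set: seq X] n)%:R)%R.

Definition generic (R : realType) (X : finType) (S : set (seq X)) :=
  rho R S n @[n --> \oo] --> (1 : R)%R.

Definition strongly_generic (R : realType) (X : finType) (S : set (seq X)) :=
  generic R S /\
  exists sigma K : R, [/\ (0 <= sigma < 1)%R, (0 < K)%R &
    forall n : nat, (1 <= n)%N -> (1 - rho R S n <= K * sigma ^+ n)%R].

Definition generically_in (R : realType) (C : complexity_class) (X : finType)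
    (D : set (seq X)) :=
  exists M : machine X,
    [/\ has_mode (class_mode C) M, correct M D &
        exists2 S, generic R S & decides_on C M S].

Definition strongly_generically_in (R : realType) (C : complexity_class)
    (X : finType) (D : set (seq X)) :=
  exists M : machine X,
    [/\ has_mode (class_mode C) M, correct M D &
        exists2 S, strongly_generic R S & decides_on C M S].

Section Groups.
Local Open Scope group_scope.

(* [inr a] is the formal inverse of the generator [inl a]. *)
Definition letter_value (G : groupType) (A : Type) (pi : A -> G) (x : A + A) :
    G :=
  match x with inl a => pi a | inr a => (pi a)^-1 end.

Definition word_value (G : groupType) (A : Type) (pi : A -> G)
    (w : seq (A + A)) : G :=
  foldr (fun x g => letter_value pi x * g) 1 w.

Definition generating (G : groupType) (A : Type) (pi : A -> G) :=
  forall g : G, exists w, word_value pi w = g.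

Definition finitely_generated (G : groupType) :=
  exists (A : finType) (pi : A -> G), generating pi.

Definition WP (G : groupType) (A : Type) (pi : A -> G) : set (seq (A + A)) :=
  [set w | word_value pi w = 1].

Definition word_problem_in (C : complexity_class) (G : groupType) :=
  forall (A : finType) (pi : A -> G), generating pi -> in_class C (WP pi).

Definition word_problem_generically_in (R : realType) (C : complexity_class)
    (G : groupType) :=
  forall (A : finType) (pi : A -> G), generating pi ->
    generically_in R C (WP pi).

Definition word_problem_strongly_generically_in (R : realType)
    (C : complexity_class) (G : groupType) :=
  forall (A : finType) (pi : A -> G), generating pi ->
    strongly_generically_in R C (WP pi).

Definition finite_index (G : groupType) (P : pred G) (H : subGroupType P) :=
  finite_set (range (fun g : G => range (fun h : H => g * val h))).

(* Invariant means: finitely additive left-invariant probability measures. *)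
Definition amenable (R : realType) (G : groupType) :=
  exists mu : set G -> R,
    [/\ forall A, (0 <= mu A)%R,
        mu setT = 1%R,
        forall A B, A `&` B = set0 -> mu (A `|` B) = (mu A + mu B)%R &
        forall (g : G) A, mu [set g * x | x in A] = mu A].

End Groups.

(* Main.v *)
Require Import Defs.
From mathcomp Require Import all_boot all_order all_algebra.
From mathcomp Require Import all_classical all_reals all_analysis.
From mathcomp Require Import ring lra zify.
Set Implicit Arguments.
Unset Strict Implicit.
Unset Printing Implicit Defensive.
Import Order.TTheory GRing.Theory Num.Theory.
Import numFieldNormedType.Exports.
Local Open Scope classical_set_scope.

(* A finite transducer tracking cosets of H rewrites a word w over the
   generators of G, letter by letter, into a word over Schreier generators pushed
   to Gbar. A machine for the word problem of Gbar can be run on the rewritten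
   word with no overhead in time or space. If it rejects, then w <> 1 in G; if it
   accepts, no decision is taken, and w then leads the walk on the cosets of
   ker phi in G from the base vertex into a set of [G : H] vertices.

   This coset graph is infinite, connected and regular. If the probabilities to
   be in a fixed finite set T at time k are at most b, uniformly in the starting
   point, then 2N steps later they are at most b - c (b - |T| / N) for some c > 0,
   since at least N vertices can be reached in 2N steps and one of them has
   probability at most |T| / N at time k. Hence these probabilities tend to 0.

   If they do not decay exponentially, then the l^2 norm of some of these
   probability functions f is almost preserved by averaging over the generators.
   The parallelogram identity makes the translates of f by the generators almost
   equal in l^2, so f^2 is almost invariant in l^1; an ultralimit gives an
   invariant mean on the coset graph, whose restriction to the coset H (after
   normalization) is an invariant mean on Gbar. *)

(** * Coordinates on a finite index subgroup *)

Section Coordinates.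
Local Open Scope group_scope.
Variables (G : groupType) (P : pred G) (H : subGroupType P).

Lemma coset_coordinates : finite_index H ->
  exists (n : nat) (r : 'I_n -> G) (idx : G -> 'I_n) (hpart : G -> H),
    (forall g, g = r (idx g) * val (hpart g)) /\
    (forall i (h : H), idx (r i * val h) = i).
Proof.
move=> /finite_seqP[s sE].
pose coset (g : G) : set G := range (fun h : H => g * val h).
have coset_in g : coset g \in s.
  suff: [set` s] (coset g) by [].
  by rewrite -sE; exists g.
have cosetM g (h : H) : coset (g * val h) = coset g.
  apply/seteqP; split=> x [k _ <-] /=.
    by exists (h * k) => //; rewrite gmulfM mulgA.
  by exists (h^-1 * k) => //; rewrite gmulfM gmulfV mulgA mulgK.
(* Once duplicates are removed, every position of the list is the index of the coset stored there,
   so every [i] has a representative. *)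
have ltu g : index (coset g) (undup s) < size (undup s).
  by rewrite index_mem mem_undup.
pose idx g := Ordinal (ltu g).
have idxE g g' : idx g = idx g' -> exists h : H, g = g' * val h.
  move=> /(congr1 val) /= e0.
  have e : coset g = coset g' by apply: (index_inj set0 _ _ e0); rewrite mem_undup.
  have: coset g g by exists 1 => //; rewrite gmulf1 mulg1.
  by rewrite e => -[h _ <-]; exists h.
have ex_r (i : 'I_(size (undup s))) : exists g, idx g = i.
  have: [set` s] (nth set0 (undup s) i) by rewrite /= -mem_undup mem_nth.
  rewrite -sE => -[g _ e]; exists g; apply/val_inj => /=.
  by rewrite /coset e index_uniq ?undup_uniq.
have [r rE] := choice ex_r.
have ex_hpart g : exists h : H, g = r (idx g) * val h by apply: idxE; rewrite rE.
have [hpart hpartE] := choice ex_hpart.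
exists (size (undup s)), r, idx, hpart; split=> // i h.
rewrite -[RHS]rE; apply/val_inj => /=.
by rewrite cosetM.
Qed.
End Coordinates.

(** * Machines run behind a reversible transducer *)

Section Transduction.
Variables (X Y : Type) (I : finType) (nxt prv : I -> X -> I) (out : I -> X -> Y).

Hypothesis nxtK : forall i x, prv (nxt i x) x = i.

Fixpoint transduce (i : I) (w : seq X) : seq Y :=
  if w is x :: w' then out i x :: transduce (nxt i x) w' else [::].

Lemma size_transduce i w : size (transduce i w) = size w.
Proof. by elim: w i => //= x w IH i; rewrite IH. Qed.

Definition state_before (i : I) (leftwards : bool) (a : input_symbol X) :=
  if leftwards then if a is Letter x then prv i x else i else i.

Definition state_after (i : I) (a : input_symbol X) :=
  if a is Letter x then nxt i x else i.

Definition out_symbol (i : I) (a : input_symbol X) : input_symbol Y :=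
  match a with
  | LeftEnd => LeftEnd
  | Letter x => Letter (out i x)
  | RightEnd => RightEnd
  end.

Definition lift_action k (Q Gamma : Type) (i : I) (a : input_symbol X)
    (u : action k Q Gamma) : action k (Q * I * bool) Gamma :=
  Action (next_state u, if input_move u is MoveRight then state_after i a else i,
          if input_move u is MoveLeft then true else false)
         (input_move u) (tape_actions u).

Variables (M : machine Y) (i0 : I).

(* Simulates M on the transduced input, step by step. The transducer state
   stored next to the state of M is the one before the scanned letter, or the
   one after it if the head has just moved left; in the latter case the former
   is recovered by [prv]. Accepting states of M give no decision. *)
Definition transducing_machine : machine X :=
  @Machine X (ntapes M) (state M * I * bool)%type (symbol M)
    (start M, i0, false)
    (blank M)
    (fun q a s => let i := state_before q.1.2 q.2 a in
       [set lift_action i a u | u in trans q.1.1 (out_symbol i a) s])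
    (fun q => if verdict q.1.1 is Some false then Some false else None).

Variable w : seq X.
Local Notation N := transducing_machine.
Local Notation tw := (transduce i0 w).

(** Position 0 holds the left end marker and the letters start at position 1; the truncated
    predecessor gives [i0] at both positions. *)
Definition state_at (p : nat) : I := foldl nxt i0 (take p.-1 w).

Definition project (c : config N) : config M :=
  @Config Y M (cstate c).1.1 (cinput c) (ctapes c).

Definition synchronized (c : config N) :=
  cinput c <= (size w).+1 /\
  state_before (cstate c).1.2 (cstate c).2 (read_input w (cinput c)) =
    state_at (cinput c).

Lemma read_inputE p : p <= size w ->
  read_input w p.+1 = if drop p w is x :: _ then Letter x else RightEnd.
Proof.
rewrite /read_input /= => le_p; elim: w p le_p => [|x v IH] [|p] //= le_p.
exact: IH.
Qed.

Lemma read_transduce p : p <= (size w).+1 ->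
  read_input tw p = out_symbol (state_at p) (read_input w p).
Proof.
case: p => // p; rewrite /state_at /read_input /=.
elim: w i0 p => [|x v IH] i [|p] //= le_p.
exact: IH.
Qed.

Lemma state_at_after p : p <= (size w).+1 ->
  state_at (minn p.+1 (size w).+1) = state_after (state_at p) (read_input w p).
Proof.
case: p => [|p] le_p; first by rewrite minnSS min0n.
rewrite read_inputE // minnSS /state_at /=.
have [lt_p|ge_p] := ltnP p (size w).
  rewrite (minn_idPl lt_p); case Ed: (drop p w) => [|x v].
    by move/(congr1 size): Ed; rewrite size_drop /= => /eqP; rewrite subn_eq0 leqNgt lt_p.
  rewrite (take_nth x lt_p) -cats1 foldl_cat /=; congr (nxt _ _).
  by rewrite -[in LHS](cat_take_drop p w) nth_cat size_takel ?ltnn ?subnn ?Ed.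
rewrite (minn_idPr _) 1?leqW // drop_oversize //=.
by rewrite (take_oversize ge_p) take_size.
Qed.

(** After a move to the left, the stored state is the one reached after the letter now scanned, so
    [prv] undoes that letter. At an end marker there is nothing to undo. *)
Lemma state_at_before p : p <= (size w).+1 ->
  state_before (state_at p) true (read_input w p.-1) = state_at p.-1.
Proof.
case: p => [|[|p]] //= le_p.
have := state_at_after (leqW (le_p : p.+1 <= size w)).
rewrite minnSS (minn_idPl (le_p : p.+1 <= size w)) => ->.
by case: (read_input w p.+1) => //= x; rewrite nxtK.
Qed.

Lemma project_perform i a (u : action (ntapes M) (state M) (symbol M)) c :
  project (@perform _ N w (lift_action i a u) c) = perform tw u (project c).
Proof. by rewrite /perform /project /= /move_input size_transduce. Qed.

Lemma project_step c c' : synchronized c -> step w c c' ->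
  synchronized c' /\ step tw (project c) (project c').
Proof.
move=> [le_p sync] [_ [u Mu <-] ->]; rewrite sync in Mu *.
split; last by exists u; rewrite ?read_transduce ?project_perform.
rewrite /synchronized /=; case: (input_move u) => /=.
- by split; [exact: leq_trans (leq_pred _) le_p|exact: state_at_before].
- by [].
- by rewrite geq_minr state_at_after.
Qed.

Lemma lift_step c d : synchronized c -> step tw (project c) d ->
  exists2 c', step w c c' & project c' = d.
Proof.
move=> [le_p sync] [u Mu ->].
exists (@perform _ N w (lift_action (state_at (cinput c)) (read_input w (cinput c)) u) c).
  eexists; last by [].
  by exists u; rewrite sync -?read_transduce.
exact: project_perform.
Qed.

Lemma synchronized_init : synchronized (init N).
Proof. by rewrite /synchronized /= /state_at take0. Qed.

Lemma project_run n c : run w n c -> synchronized c /\ run tw n (project c).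
Proof.
elim=> [|{}n {}c c' _ [sync rc] stp].
  by split; [exact: synchronized_init|exact: (@run_init Y M)].
have [sync' stp'] := project_step sync stp.
by split=> //; exact: run_step rc stp'.
Qed.

Lemma lift_run n d : run tw n d -> exists2 c, run w n c & project c = d.
Proof.
elim=> [|{}n {}d d' _ [c rc <-] stp]; first by exists (init N); [exact: (@run_init X N)|].
have [sync _] := project_run rc.
have [c' stp' <-] := lift_step sync stp.
by exists c' => //; exact: run_step rc stp'.
Qed.

Lemma project_halted n c : run w n c -> halted w c <-> halted tw (project c).
Proof.
move=> /project_run[sync _]; split=> halt.
  by move=> d /(lift_step sync)[c' /halt].
by move=> c' /(project_step sync)[_ /halt].
Qed.

Lemma transducing_machine_terminates : terminates M tw -> terminates N w.
Proof.
move=> term [c [c0 cS]]; apply: term; exists (project \o c).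
have sync n : synchronized (c n).
  elim: n => [|n IH]; first by rewrite c0; exact: synchronized_init.
  by have [] := project_step IH (cS n).
by split=> [|n] /=; [rewrite c0|have [] := project_step (sync n) (cS n)].
Qed.

Lemma transducing_machine_accepts : ~ accepts N w.
Proof. by move=> [n [c [_ _ /=]]]; case: (verdict _) => [[]|]. Qed.

Lemma transducing_machine_rejects : rejects M tw -> rejects N w.
Proof.
move=> [term rej]; split; first exact: transducing_machine_terminates.
move=> n c rc hc; have [_ rc'] := project_run rc.
by rewrite /= (rej _ _ rc' ((project_halted rc).1 hc)).
Qed.

(** An accepting computation of [M] lifts to a halting computation of [N] without a decision,
    whereas rejection requires all halting computations to decide negatively. *)
Lemma rejects_transducing_machine : rejects N w -> ~ accepts M tw.
Proof.
move=> [_ rej] [n [d [rd hd vd]]]; have [c rc cd] := lift_run rd.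
have hc : halted w c by apply/(project_halted rc); rewrite cd.
by have := rej n c rc hc; rewrite -cd /= in vd *; rewrite vd.
Qed.

Lemma transducing_machine_time t : time_within M tw t -> time_within N w t.
Proof. by move=> tM n c /project_run[_ /tM]. Qed.

Lemma transducing_machine_space s : space_within M tw s -> space_within N w s.
Proof. by move=> sM n c /project_run[_ /sM]. Qed.

End Transduction.

Lemma transducing_machine_deterministic X Y (I : finType) (nxt prv : I -> X -> I)
    (out : I -> X -> Y) (M : machine Y) i :
  deterministic M -> deterministic (transducing_machine nxt prv out M i).
Proof. by move=> detM q x s _ _ [u Mu <-] [v Mv <-]; rewrite (detM _ _ _ _ _ Mu Mv). Qed.

(** [M] decides [E] on all words, so it rejects every transduced word outside [E], and [N] follows
    it. A rejection is sound because words of [D] are transduced into [E]. The resource bounds carry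
    over because transduction preserves length. *)
Lemma transduced_complement (C : complexity_class) (X Y S : finType)
    (nxt prv : S -> X -> S) (out : S -> X -> Y) (i : S)
    (D : set (seq X)) (E : set (seq Y)) :
  (forall j x, prv (nxt j x) x = j) -> in_class C E ->
  (forall w, D w -> E (transduce nxt out i w)) ->
  exists N : machine X, [/\ has_mode (class_mode C) N, correct N D &
    decides_on C N [set w | ~ E (transduce nxt out i w)]].
Proof.
move=> nxtK [M [Mmode Mcor [Mdec Mbnd]]] DE.
have rejM w : ~ accepts M w -> rejects M w.
  by case: (Mdec w I) => _ [].
have sizeT v := size_transduce nxt out i v.
exists (transducing_machine nxt prv out M i); split.
- move: Mmode; case: (class_mode C) => //=.
  exact: transducing_machine_deterministic.
- move=> w; split=> [/transducing_machine_accepts//|].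
  move=> /(rejects_transducing_machine nxtK)/rejM rej /DE.
  exact: (Mcor _).2.
- split=> [w nEw|].
    have rej : rejects M (transduce nxt out i w) by apply: rejM => /(Mcor _).1.
    have rejN := transducing_machine_rejects nxtK rej.
    by split; [exact: rejN.1|right].
  case: (class_resources C) Mbnd => [F|F|F F'] /=.
  + move=> [f Ff Mf]; exists f => // w _; rewrite -(sizeT w).
    exact/transducing_machine_time/Mf.
  + move=> [f Ff Mf]; exists f => // w _; rewrite -(sizeT w).
    exact/transducing_machine_space/Mf.
  + move=> [f [f' [Ff Ff' Mf]]]; exists f, f'; split=> // w _; rewrite -(sizeT w).
    have [tM sM] := Mf (transduce nxt out i w) I.
    by split; [exact: transducing_machine_time tM|exact: transducing_machine_space sM].
Qed.

(** * Ultralimits and random walks *)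

Lemma fmap_ultra (A B : Type) (f : A -> B) (F : set_system A) :
  UltraFilter F -> UltraFilter (f @ F).
Proof.
move=> FU; split; first exact: fmap_proper_filter.
move=> G GF sFG; apply/seteqP; split=> [E GE|]; last exact: sFG.
have [//|FnE] := in_ultra_setVsetC (f @^-1` E) FU.
have GnE : G (~` E) by exact: sFG.
by have /filter_ex[? []] : G (E `&` ~` E) by exact: filterI.
Qed.

Lemma big_tuple_cons (R : Type) (idx : R) (op : Monoid.com_law idx) (X : finType)
    (k : nat) (F : seq X -> R) :
  \big[op/idx]_(t : k.+1.-tuple X) F t =
  \big[op/idx]_x \big[op/idx]_(t : k.-tuple X) F (x :: t).
Proof.
rewrite pair_big /= (reindex (fun u : X * k.-tuple X => [tuple of u.1 :: u.2])) //=.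
exists (fun t => (thead t, [tuple of behead t])) => [[x t] _|t _] /=.
  by congr pair; apply/val_inj.
by case/tupleP: t => x t; apply/val_inj.
Qed.

Section Walk.
Local Open Scope ring_scope.
Variables (R : realType) (X : finType) (V : choiceType).
Variables (act : V -> X -> V) (inv : X -> X).
Hypothesis invK : involutive inv.
Hypothesis actK : forall v x, act (act v x) (inv x) = v.
Variable T : seq V.

Local Notation n := (#|X|%:R : R).
Local Notation t := ((size T)%:R : R).

(* The probability that the simple random walk started at u is in T at time k
   (possibly not for the first time). *)
Fixpoint hitting (k : nat) (u : V) : R :=
  if k is k'.+1 then (\sum_x hitting k' (act u x)) / n else (u \in T)%:R.

Lemma actVK v x : act (act v (inv x)) x = v.
Proof. by rewrite -[X in act _ X]invK actK. Qed.

Lemma act_inj x : injective (act^~ x).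
Proof. exact: (@can_inj _ _ _ (act^~ (inv x)) (fun v => actK v x)). Qed.

Lemma hitting_ge0 k u : 0 <= hitting k u.
Proof.
elim: k u => /= [|k IH] u; first exact: ler0n.
by rewrite divr_ge0 // sumr_ge0.
Qed.

Hypothesis X_gt0 : (0 < #|X|)%N.

Let n_gt0 : 0 < n. Proof. by rewrite ltr0n. Qed.
Let n_neq0 : n != 0. Proof. by rewrite gt_eqF. Qed.

Lemma hittingD l k u :
  hitting (l + k) u = (\sum_(w : l.-tuple X) hitting k (foldl act u w)) / n ^+ l.
Proof.
elim: l u => [|l IH] u.
  rewrite expr0 divr1 add0n (big_pred1 [tuple]) // => w.
  by rewrite [w]tuple0 /= eqxx.
rewrite addSn /= (big_tuple_cons _ l (fun w => hitting k (foldl act u w))).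
under eq_bigr do rewrite IH.
by rewrite -mulr_suml exprSr invfM mulrA.
Qed.

Lemma hitting_count k u :
  #|[pred w : k.-tuple X | foldl act u w \in T]|%:R = n ^+ k * hitting k u.
Proof.
rewrite -[in hitting k u](addn0 k) hittingD /= mulrCA divff ?expf_neq0 // mulr1.
rewrite -sum1_card natr_sum big_mkcond /=.
by apply: eq_bigr => w _; rewrite inE; case: ifP.
Qed.

(** At time 0 the sum counts points of [T]. Each letter maps distinct starting points to distinct
    points, so averaging over letters keeps the bound. *)
Lemma sum_hitting_le k s : uniq s -> \sum_(u <- s) hitting k u <= t.
Proof.
elim: k s => [|k IH] s us.
  rewrite /= -natr_sum ler_nat -big_mkcond /= sum1_count -size_filter.
  by apply: uniq_leq_size; [exact: filter_uniq|move=> v; rewrite mem_filter => /andP[]].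
rewrite /= -mulr_suml exchange_big /= ler_pdivrMr // mulr_natr -sumr_const.
apply: ler_sum => x _; rewrite -(big_map (act^~ x) xpredT (hitting k)).
by apply: IH; rewrite map_inj_uniq //; exact: act_inj.
Qed.

Lemma hitting_le_mono k l b :
  (forall u, hitting k u <= b) -> (k <= l)%N -> forall u, hitting l u <= b.
Proof.
move=> kb /subnK <-; elim: (l - k)%N => [|i IH] u //=.
rewrite ler_pdivrMr // mulr_natr -sumr_const.
exact: ler_sum.
Qed.

(** * Vanishing of the hitting probabilities on an infinite connected graph *)

Definition even_sphere (j : nat) (u : V) : seq V :=
  undup [seq foldl act u (w : seq X) | w : j.*2.-tuple X].

Lemma even_sphereP j u v :
  reflect (exists2 w, size w = j.*2 & foldl act u w = v) (v \in even_sphere j u).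
Proof.
rewrite mem_undup; apply: (iffP codomP) => [[w ->]|[w sw <-]].
  by exists w; rewrite ?size_tuple.
by exists (Tuple (introT eqP sw)).
Qed.

Hypothesis V_infinite : infinite_set [set: V].
Hypothesis V_connected : forall u v, exists w, foldl act u w = v.

(** Backtracking along a letter makes these sets increase with [j]. If one of them did not grow, it
    would be closed under two-letter words; by connectedness every vertex would then lie in it or
    one step away from it, and the graph would be finite. *)
Lemma size_even_sphere j u : (j < size (even_sphere j u))%N.
Proof.
elim: j => [|j IH].
  have : u \in even_sphere 0 u by apply/even_sphereP; exists [::].
  by case: (even_sphere 0 u).
apply: leq_ltn_trans IH _; rewrite ltnNge; apply/negP => le_size.
set E := even_sphere j u in le_size *.
have [x0 _] := card_gt0P X_gt0.
have sub : {subset E <= even_sphere j.+1 u}.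
  move=> v /even_sphereP[w sw wv]; apply/even_sphereP; exists (w ++ [:: x0; inv x0]).
    by rewrite size_cat sw addn2.
  by rewrite foldl_cat wv /= actK.
have [_ eqE] := uniq_min_size (undup_uniq _) sub le_size.
have closed v x y : v \in E -> act (act v x) y \in E.
  move=> /even_sphereP[w sw wv]; rewrite eqE; apply/even_sphereP.
  exists (w ++ [:: x; y]); first by rewrite size_cat sw addn2.
  by rewrite foldl_cat wv.
apply: V_infinite; apply/finite_seqP.
exists (E ++ [seq act v x | v <- E, x <- enum X]); apply/seteqP; split=> // v _ /=.
have uE : u \in E.
  apply/even_sphereP; exists (flatten (nseq j [:: x0; inv x0])).
    by elim: j {le_size sub eqE closed E} => //= j IH; rewrite IH.
  by elim: j {le_size sub eqE closed E} => //= j IH; rewrite actK.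
have [w <-] := V_connected u v.
move: (u) uE; have [k] := ubnP (size w); elim: k w => // k IH [|x [|y w]] /=.
- by move=> _ z zE; rewrite mem_cat zE.
- by move=> _ z zE; rewrite mem_cat orbC allpairs_f ?mem_enum.
- by move=> /ltnW lt_k z zE; apply: IH; [|exact: closed].
Qed.

(* Among the more than N vertices at an even distance at most 2N from u, at
   least one is hit with probability at most t / N. *)
Lemma hitting_contraction N k b : (0 < N)%N -> t / N%:R <= b ->
  (forall u, hitting k u <= b) ->
  forall u, hitting (N.*2 + k) u <= b - (b - t / N%:R) / n ^+ N.*2.
Proof.
move=> N_gt0 tb kb u; set c := t / N%:R in tb *.
have [v vE vc] : exists2 v, v \in even_sphere N u & hitting k v <= c.
  apply: contrapT => /forall2NP none; have /hasP[v0 v0E _] : has predT (even_sphere N u).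
    by rewrite has_predT (leq_ltn_trans _ (size_even_sphere N u)).
  have : \sum_(v <- even_sphere N u) c < t.
    apply: lt_le_trans (sum_hitting_le k (undup_uniq _)).
    rewrite big_seq [ltRHS]big_seq; apply: ltr_sum; first by apply/hasP; exists v0.
    by move=> v vE; have [//|/negP] := none v; rewrite -ltNge.
  rewrite big_const_seq iter_addr_0 count_predT => /lt_geF /negP; apply.
  have -> : t = c *+ N by rewrite -[RHS]mulr_natr divfK // pnatr_eq0 -lt0n.
  by rewrite ler_wpMn2l ?divr_ge0 //; exact: ltnW (size_even_sphere N u).
rewrite hittingD ler_pdivrMr ?exprn_gt0 // mulrBl divfK ?expf_neq0 //.
(* One path leads to [v] and contributes at most [c]; each of the other [#|X| ^ N.*2 - 1] paths
   contributes at most [b]. *)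
have [w sw wv] := even_sphereP _ _ _ vE.
pose wt := Tuple (introT eqP sw).
rewrite (bigD1 wt) //= wv.
have : \sum_(i | i != wt) hitting k (foldl act u i) <= \sum_(i | i != wt) b.
  by apply: ler_sum => i _; exact: kb.
rewrite sumr_const cardC1 card_tuple => sum_le.
have -> : b * n ^+ N.*2 - (b - c) = c + b *+ (#|X| ^ N.*2).-1.
  rewrite -natrX -[b *+ _]mulr_natr -subn1 natrB ?expn_gt0 ?X_gt0 //; ring.
exact: lerD.
Qed.

Lemma hitting_cvg0 (e : R) : 0 < e -> \forall k \near \oo, forall u, hitting k u <= e.
Proof.
move=> e_gt0.
have [N N_gt0 cN] : exists2 N, (0 < N)%N & t / N%:R <= e / 2.
  exists (Num.truncn (t / (e / 2))).+1 => //.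
  rewrite ler_pdivrMr ?ltr0n // mulrC -ler_pdivrMr ?divr_gt0 //.
  exact/ltW/truncnS_gt.
(* Each block of [N.*2] steps multiplies the excess of the bound over [c] by [q]. *)
set c := t / N%:R in cN; set q := 1 - 1 / n ^+ N.*2.
have iter_le i u : hitting (i * N.*2) u <= c + q ^+ i.
  elim: i u => [|i IH] u.
    rewrite mul0n expr0 /= (@le_trans _ _ 1) //; first by case: (u \in T).
    by rewrite lerDr divr_ge0.
  rewrite mulSn; apply: le_trans (hitting_contraction N_gt0 _ IH u) _.
    by rewrite lerDl exprn_ge0 // subr_ge0 ler_pdivrMr ?mul1r ?exprn_ege1 ?exprn_gt0 // ler1n.
  by rewrite -/c exprS /q; lra.
have [i qi] : exists i, q ^+ i <= e / 2.
  have q_lt1 : `|q| < 1.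
    have ge1 : 1 <= n ^+ N.*2 by rewrite exprn_ege1 // ler1n.
    rewrite ger0_norm /q ?subr_ge0 ?gtrBl ?divr_gt0 ?ler_pdivrMr ?mul1r //; exact: lt_le_trans ge1.
  have /cvgrPdist_le /(_ (e / 2)) := cvg_expr q_lt1.
  case=> [|i _ /(_ i (leqnn i))]; first by rewrite divr_gt0.
  by rewrite sub0r normrN => /(le_trans (ler_norm _)) ?; exists i.
exists (i * N.*2)%N => // k /= le_k; apply: hitting_le_mono le_k => u.
by apply: le_trans (iter_le i u) _; lra.
Qed.

(** * The l^2 norm of the hitting probabilities *)

Definition supported (s : seq V) (g : V -> R) := forall v, v \notin s -> g v = 0.

(** This sum takes the default value 0 when the support is infinite, so its evaluation goes through
    an explicit finite support. *)
Definition total (g : V -> R) : R := \sum_(v \in [set: V]) g v.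

Lemma totalE s g : uniq s -> supported s g -> total g = \sum_(v <- s) g v.
Proof. by move=> us sg; rewrite bigfs // => [|v _ /sg //]; apply: eq_fsbigl; apply/seteqP. Qed.

Lemma total_act x g : total (fun v => g (act v x)) = total g.
Proof.
rewrite /total [RHS](@reindex_fsbigT _ _ _ _ _ (act^~ x)) //.
by apply: (Bijective (g := act^~ (inv x))) => v; [exact: actK|exact: actVK].
Qed.

(** A common support for the function and its one-letter translates allows their sums to be compared
    term by term. *)
Lemma hitting_supported k : exists s, [/\ uniq s, supported s (hitting k) &
  forall x, supported s (fun v => hitting k (act v x))].
Proof.
suff [s sk] : exists s, supported s (hitting k).
  exists (undup (s ++ [seq act v (inv x) | v <- s, x <- enum X])); split.
  - exact: undup_uniq.
  - by move=> v; rewrite mem_undup mem_cat negb_or => /andP[/sk].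
  - move=> x v; rewrite mem_undup mem_cat negb_or => /andP[_]; apply: contraNeq => vx.
    have vs : act v x \in s by apply: contraNT vx => /sk ->.
    by rewrite -(actK v x); apply: allpairs_f; rewrite ?mem_enum.
elim: k => [|k [s sk]].
  by exists T => v /= /negbTE ->.
exists [seq act v (inv x) | v <- s, x <- enum X] => v vs /=.
rewrite big1 ?mul0r // => x _; apply: sk; apply: contraNN vs => vs.
by rewrite -(actK v x); apply: allpairs_f; rewrite ?mem_enum.
Qed.

Definition energy k : R := total (fun v => hitting k v ^+ 2).

Lemma sqr_hitting_le k u : hitting k u ^+ 2 <= energy k.
Proof.
have [s [us sk _]] := hitting_supported k.
rewrite /energy (totalE us) => [|v /sk ->]; last by rewrite expr0n.
have [u_s|/sk ->] := boolP (u \in s); last first.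
  by rewrite expr0n sumr_ge0 // => v _; exact: sqr_ge0.
by rewrite (big_rem u) //= lerDl sumr_ge0 // => v _; exact: sqr_ge0.
Qed.

Lemma energy_ge0 k : 0 <= energy k.
Proof. by apply: fsumr_ge0 => v _; exact: sqr_ge0. Qed.

(** Write f_x for the translates of f = [hitting k]. They all have the norm of f, and their average
    is [hitting k.+1]; hence the right-hand side is exactly the sum of the squared norms of f_x -
    f_y over all pairs, of which one term is kept. *)
Lemma total_sqr_diff_le k x y :
  total (fun v => (hitting k (act v x) - hitting k (act v y)) ^+ 2) <=
  2 * n ^+ 2 * (energy k - energy k.+1).
Proof.
have [s [us sk skx]] := hitting_supported k.
have diffE x' y' : total (fun v => (hitting k (act v x') - hitting k (act v y')) ^+ 2)
    = \sum_(v <- s) (hitting k (act v x') - hitting k (act v y')) ^+ 2.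
  by apply: totalE => // v vs; rewrite !skx // subr0 expr0n.
have eE x' : energy k = \sum_(v <- s) hitting k (act v x') ^+ 2.
  rewrite /energy -(total_act x'); apply: totalE => // v vs.
  by rewrite skx // expr0n.
have eSE : n ^+ 2 * energy k.+1 = \sum_(v <- s) (\sum_x' hitting k (act v x')) ^+ 2.
  rewrite /energy (totalE us) => [|v vs /=].
    rewrite mulr_sumr; apply: eq_bigr => v _ /=.
    by rewrite -exprMn mulrC divfK.
  by rewrite big1 ?mul0r ?expr0n // => z _; exact: skx.
have -> : 2 * n ^+ 2 * (energy k - energy k.+1) =
    \sum_x' \sum_y' \sum_(v <- s) (hitting k (act v x') - hitting k (act v y')) ^+ 2.
  have -> : 2 * n ^+ 2 * (energy k - energy k.+1) =
      \sum_(x' : X) \sum_(y' : X) (energy k + energy k) - 2 * (n ^+ 2 * energy k.+1).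
    by rewrite !sumr_const -mulrnA -[(_ + _) *+ _]mulr_natr natrM; ring.
  have -> : \sum_(x' : X) \sum_(y' : X) (energy k + energy k) = \sum_x' \sum_y'
      \sum_(v <- s) (hitting k (act v x') ^+ 2 + hitting k (act v y') ^+ 2).
    apply: eq_bigr => x' _; apply: eq_bigr => y' _.
    by rewrite big_split /= -!eE.
  have -> : 2 * (n ^+ 2 * energy k.+1) = \sum_x' \sum_y'
      \sum_(v <- s) 2 * (hitting k (act v x') * hitting k (act v y')).
    rewrite eSE mulr_sumr.
    under [RHS]eq_bigr do rewrite exchange_big /=.
    rewrite [RHS]exchange_big /=; apply: eq_bigr => v _.
    rewrite expr2 mulr_suml mulr_sumr; apply: eq_bigr => x' _.
    by rewrite !mulr_sumr.
  rewrite -sumrB; apply: eq_bigr => x' _; rewrite -sumrB; apply: eq_bigr => y' _.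
  by rewrite -sumrB; apply: eq_bigr => v _; ring.
rewrite diffE (bigD1 x) //= (bigD1 y) //= -addrA lerDl.
rewrite addr_ge0 ?sumr_ge0 // => *; rewrite ?sumr_ge0 // => *; rewrite ?sumr_ge0 // => *;
  exact: sqr_ge0.
Qed.

(** * Almost invariant means and their ultralimits *)

Definition preim_act (x : X) (E : set V) : set V := [set v | E (act v x)].

Definition mean (m : set V -> R) :=
  [/\ forall E, 0 <= m E, m setT = 1 &
      forall E F, E `&` F = set0 -> m (E `|` F) = m E + m F].

Definition hitting_mean k (E : set V) : R :=
  total (fun v => \1_E v * hitting k v ^+ 2) / energy k.

Lemma hitting_meanP k : 0 < energy k -> mean (hitting_mean k).
Proof.
move=> e_gt0; have [s [us sk _]] := hitting_supported k.
have sE E : supported s (fun v => \1_E v * hitting k v ^+ 2).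
  by move=> v /sk ->; rewrite expr0n mulr0.
split=> [E||E F EF].
- by rewrite divr_ge0 ?energy_ge0 // fsumr_ge0 // => v _; rewrite mulr_ge0 ?sqr_ge0 // indicE.
- rewrite /hitting_mean (_ : (fun v => _) = (fun v => hitting k v ^+ 2)) ?divff ?gt_eqF //.
  by apply/funext => v; rewrite indicT mul1r.
- rewrite /hitting_mean !(totalE us) // -mulrDl -big_split; congr (_ / _).
  apply: eq_bigr => v _ /=; rewrite -mulrDl; congr (_ * _).
  rewrite !indicE in_setU; case: (boolP (v \in E)) => vE; last by rewrite add0r.
  case: (boolP (v \in F)) => vF; last by rewrite addr0.
  have : (E `&` F) v by split; [exact/set_mem|exact/set_mem].
  by rewrite EF.
Qed.

(** The factor [(d / n) ^+ 2] cancels the [n ^+ 2] of [total_sqr_diff_le]: translates differ in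
    squared l^2 norm by at most [2 * d ^+ 2 * energy k], and closeness in l^2 makes the squares
    close in l^1. *)
Lemma hitting_mean_almost_invariant k d : 0 < d ->
  (1 - (d / n) ^+ 2) * energy k < energy k.+1 ->
  0 < energy k /\
  forall x y E, hitting_mean k (preim_act x E) - hitting_mean k (preim_act y E) <= 3 * d.
Proof.
move=> d_gt0 e_lt.
have diff_le x y : total (fun v => (hitting k (act v x) - hitting k (act v y)) ^+ 2) <=
    2 * d ^+ 2 * energy k.
  apply: le_trans (total_sqr_diff_le k x y) _.
  have -> : 2 * d ^+ 2 * energy k = 2 * n ^+ 2 * ((d / n) ^+ 2 * energy k).
    by field.
  rewrite ler_pM2l ?mulr_gt0 ?exprn_gt0 //; lra.
(* The energy never increases, so the strict hypothesis leaves [(d / n) ^+ 2 * energy k]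
   positive. *)
have e_gt0 : 0 < energy k.
  have [x0 _] := card_gt0P X_gt0.
  have : 0 <= 2 * n ^+ 2 * (energy k - energy k.+1).
    apply: le_trans (total_sqr_diff_le k x0 x0).
    by apply: fsumr_ge0 => v _; exact: sqr_ge0.
  rewrite pmulr_rge0 ?mulr_gt0 ?exprn_gt0 // subr_ge0 => e_le.
  have : 0 < (d / n) ^+ 2 * energy k by lra.
  by rewrite pmulr_rgt0 // exprn_gt0 // divr_gt0.
split=> // x y E.
have [s [us sk skx]] := hitting_supported k.
(* The substitution of [act v z] for [v] moves the translation from the set to the function. *)
have meanE z : hitting_mean k (preim_act z E) =
    (\sum_(v <- s) \1_E v * hitting k (act v (inv z)) ^+ 2) / energy k.
  rewrite /hitting_mean; congr (_ / _).
  rewrite -(totalE us) => [|v vs]; last by rewrite skx // expr0n mulr0.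
  rewrite -[RHS](total_act z); congr total; apply/funext => v.
  by rewrite actK !indicE.
rewrite !meanE -mulrBl -sumrB ler_pdivrMr //.
set a := fun v => hitting k (act v (inv x)); set b := fun v => hitting k (act v (inv y)).
have sumE z : \sum_(v <- s) hitting k (act v (inv z)) ^+ 2 = energy k.
  rewrite /energy -(total_act (inv z)); apply/esym/totalE => // v vs.
  by rewrite skx // expr0n.
(* AM-GM: 2 d (a^2 - b^2) <= (a - b)^2 + d^2 (a + b)^2 *)
apply: (@le_trans _ _ (\sum_(v <- s)
    ((a v - b v) ^+ 2 / (2 * d) + d * (a v ^+ 2 + b v ^+ 2)))).
  apply: ler_sum => v _; rewrite -mulrBr.
  have indE : \1_E v = 0 :> R \/ \1_E v = 1 :> R.
    by rewrite indicE; case: (v \in E) => /=; [right|left].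
  have d2 : 0 < 2 * d by rewrite mulr_gt0.
  rewrite -(ler_pM2r d2) [leRHS]mulrDl divfK ?gt_eqF //.
  have := sqr_ge0 (a v - b v - d * (a v + b v)).
  have := sqr_ge0 (d * (a v - b v)).
  have := sqr_ge0 (a v - b v).
  have : 0 <= d ^+ 2 * a v ^+ 2 by rewrite mulr_ge0 ?sqr_ge0.
  have : 0 <= d ^+ 2 * b v ^+ 2 by rewrite mulr_ge0 ?sqr_ge0.
  rewrite !expr2; case: indE => ->; lra.
(* The first sum will contribute [d * energy k] and the second one [2 * d * energy k], whence the
   constant 3. *)
rewrite big_split /= -mulr_sumr big_split /= !sumE -mulr_suml.
have := diff_le (inv x) (inv y).
rewrite (totalE us) => [|v vs]; last by rewrite !skx // subr0 expr0n.
rewrite -/a -/b => D_le.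
have : (\sum_(v <- s) (a v - b v) ^+ 2) / (2 * d) <= d * energy k.
  rewrite ler_pdivrMr ?mulr_gt0 //; apply: le_trans D_le _; lra.
lra.
Qed.

Lemma mean_le1 m E : mean m -> m E <= 1.
Proof.
move=> [m_ge0 m1 mU]; rewrite -m1 -(setUv E) mU ?setICr //.
by rewrite lerDl.
Qed.

(** By compactness of [0, 1], one ultrafilter finer than the neighbourhoods of infinity gives limits
    for all sets at once, and additivity passes to the limit. *)
Lemma mean_ultralimit (m : nat -> set V -> R) : (forall i, mean (m i)) ->
  exists2 l, mean l & forall E F,
    (m i E - m i F) @[i --> \oo] --> (0 : R) -> l E = l F.
Proof.
move=> m_mean; have [U [UU ooU]] := @ultraFilterLemma _ (nbhs \oo) _.
have UF : ProperFilter U by exact: ultra_proper.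
have ex_lim E : exists l : R, 0 <= l /\ (m i E) @[i --> U] --> l.
  have := @segment_compact R 0 1; rewrite compact_ultra.
  move=> /(_ ((m i E) @[i --> U]) _) []; first exact: fmap_ultra.
    apply: (@filterS _ U _ setT); last exact: filterT.
    by move=> i _ /=; rewrite in_itv /= mean_le1 ?andbT //; have [] := m_mean i.
  by move=> l [/=]; rewrite in_itv /= => /andP[l_ge0 _] ?; exists l.
have [l lP] := choice ex_lim.
have uniq_lim (f : nat -> R) (a b : R) : f @ U --> a -> f @ U --> b -> a = b.
  by move=> fa fb; exact: (cvg_unique (@Rhausdorff R) fa fb).
exists l.
  split=> [E||E F EF]; first by have [] := lP E.
    apply: uniq_lim (lP setT).2 _.
    rewrite (_ : (fun i => _) = cst 1); first exact: cvg_cst.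
    by apply/funext => i; have [] := m_mean i.
  apply: uniq_lim (lP (E `|` F)).2 _.
  rewrite (_ : (fun i => _) = (fun i => m i E + m i F)).
    by apply: cvgD; [exact: (lP E).2|exact: (lP F).2].
  by apply/funext => i; have [_ _] := m_mean i; exact.
move=> E F EF; apply/eqP; rewrite -subr_eq0; apply/eqP.
apply: uniq_lim (cvgB (lP E).2 (lP F).2) _.
exact: cvg_trans (cvg_app _ ooU) EF.
Qed.

Lemma energy_decay q k : 0 <= q -> (forall j, energy j.+1 <= q * energy j) ->
  energy k <= energy 0 * q ^+ k.
Proof.
move=> q_ge0 decay; elim: k => [|k IH]; first by rewrite expr0 mulr1.
by apply: le_trans (decay k) _; rewrite exprS mulrCA ler_wpM2l.
Qed.

Lemma hitting_exponential :
  (forall m, mean m -> ~ forall x E, m (preim_act x E) = m E) ->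
  exists C q, 0 <= q < 1 /\ forall k u, hitting k u <= C * q ^+ k.
Proof.
move=> no_mean; apply: contrapT => no_decay.
pose d (i : nat) : R := i.+1%:R^-1.
have d_gt0 i : 0 < d i by rewrite invr_gt0.
have dn_gt0 i : 0 < (d i / n) ^+ 2 by rewrite exprn_gt0 // divr_gt0.
have dn_le1 i : (d i / n) ^+ 2 <= 1.
  apply: exprn_ile1; first exact/ltW/divr_gt0.
  rewrite ler_pdivrMr // mul1r (@le_trans _ _ 1) ?ler1n //.
  by rewrite invf_le1 ?ltr0n // ler1n.
have almost i : exists k, (1 - (d i / n) ^+ 2) * energy k < energy k.+1.
  apply/not_existsP => decay; apply: no_decay.
  set q := 1 - (d i / n) ^+ 2 in decay.
  have q_ge0 : 0 <= q by rewrite subr_ge0.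
  (* The square of a hitting probability is at most the energy, so the decay rate of the energy
     enters through its square root. *)
  exists (Num.sqrt (energy 0)), (Num.sqrt q); split.
    rewrite sqrtr_ge0 -[ltRHS]sqrtr1 ltr_sqrt ?ltr01 // /q.
    by have := dn_gt0 i; lra.
  move=> k u; rewrite -ler_sqr ?nnegrE ?hitting_ge0 ?mulr_ge0 ?exprn_ge0 ?sqrtr_ge0 //.
  rewrite exprMn exprAC !sqr_sqrtr ?energy_ge0 //.
  apply: le_trans (sqr_hitting_le k u) (energy_decay k q_ge0 _) => j.
  by have /negP := decay j; rewrite -leNgt.
have [kappa kappaP] := choice almost.
have inv_kappa i := hitting_mean_almost_invariant (d_gt0 i) (kappaP i).
have [m m_mean mP] := mean_ultralimit (fun i => hitting_meanP (inv_kappa i).1).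
have m_eq x y E : m (preim_act x E) = m (preim_act y E).
  apply: mP; apply/cvgrPdist_le => e e_gt0.
  have /cvgrPdist_le /(_ (e / 3)) := @cvg_harmonic R.
  rewrite divr_gt0 // => /(_ isT) [N _ HN]; exists N => // i /= /HN.
  rewrite /harmonic /= !sub0r !normrN gtr0_norm ?invr_gt0 ?ltr0n // -/(d i) => le_e.
  have := (inv_kappa i).2 x y E; have := (inv_kappa i).2 y x E.
  rewrite ler_norml; move: (d i) le_e => di *; apply/andP; split; lra.
have [x0 _] := card_gt0P X_gt0.
have [m_ge0 m1 mU] := m_mean.
(* So far m is only invariant under words of even length. *)
apply: (no_mean (fun E => (m E + m (preim_act x0 E)) / 2)).
  split=> [E||E F EF].
  - by rewrite divr_ge0 ?addr_ge0.
  - by rewrite (_ : preim_act x0 setT = setT) ?m1; [lra|apply/seteqP].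
  - rewrite (_ : preim_act x0 (E `|` F) = preim_act x0 E `|` preim_act x0 F) //.
    rewrite !mU //; first lra.
    by apply/seteqP; split=> v // [Ev Fv]; have : (E `&` F) (act v x0) by []; rewrite EF.
(* In the two-letter term [x0] is traded for [inv x], which cancels [x]; in the other term [x] is
   traded for [x0]. *)
move=> x E; congr (_ / 2); rewrite addrC (m_eq x0 (inv x)) (m_eq x x0).
congr (m _ + _); apply/funext => v.
by rewrite /preim_act /= actVK.
Qed.

End Walk.

(** * Densities of sets of words *)

Section Density.
Local Open Scope ring_scope.
Variables (R : realType) (X : finType) (S : set (seq X)) (e : nat -> R).
Hypothesis X_ge2 : (2 <= #|X|)%N.
Local Notation n := (#|X|%:R : R).
Hypothesis le_e :
  forall k, #|[pred w : k.-tuple X | `[< ~ S w >]]|%:R <= n ^+ k * e k.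

Let n_ge2 : 2 <= n. Proof. by rewrite ler_nat. Qed.
Let n_gt0 : 0 < n. Proof. exact: lt_le_trans n_ge2. Qed.

(** An upper bound for [1 - rho R S m], with the size of the ball replaced by that of its outermost
    sphere, [n ^+ m]. *)
Definition weighted_sum m := \sum_(k < m.+1) n ^+ k * e k / n ^+ m.

Lemma density_ge0 k : 0 <= e k.
Proof. by rewrite -(pmulr_rge0 _ (exprn_gt0 k n_gt0)) (le_trans _ (le_e k)). Qed.

Lemma weighted_sumS m : weighted_sum m.+1 <= weighted_sum m / 2 + e m.+1.
Proof.
rewrite /weighted_sum big_ord_recr /= mulrAC divff ?expf_neq0 ?gt_eqF // mul1r.
rewrite lerD2r mulr_suml; apply: ler_sum => k _.
rewrite exprS invfM [n^-1 * _]mulrC mulrA.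
apply: ler_wpM2l; first by rewrite divr_ge0 ?mulr_ge0 ?exprn_ge0 ?density_ge0 // ltW.
by rewrite lef_pV2 ?posrE.
Qed.

Lemma ball_countC m :
  (ball_count S m + ball_count [set w | ~ S w] m = ball_count [set: seq X] m)%N.
Proof.
rewrite /ball_count -big_split /=; apply: eq_bigr => k _.
rewrite [RHS](@eq_card _ _ predT) => [|w]; last by rewrite !inE; apply/asboolP.
rewrite -(cardC [pred w : k.-tuple X | `[< S w >]]); congr addn.
by apply: eq_card => w; rewrite !inE asbool_neg.
Qed.

Lemma sub1_rho m : 1 - rho R S m <= weighted_sum m.
Proof.
have le_ball : n ^+ m <= (ball_count [set: seq X] m)%:R.
  rewrite -natrX ler_nat /ball_count big_ord_recr /= -card_tuple.
  apply: leq_trans (leq_addl _ _); apply/eq_leq/eq_card => w.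
  by rewrite !inE; apply/esym/asboolP.
have ball_gt0 : 0 < (ball_count [set: seq X] m)%:R :> R.
  by apply: lt_le_trans le_ball; rewrite exprn_gt0.
rewrite /rho -[X in X - _](divff (lt0r_neq0 ball_gt0)) -mulrBl -natrB; last first.
  by rewrite -ball_countC leq_addr.
rewrite -{1}ball_countC addKn /weighted_sum -mulr_suml.
apply: ler_pM; rewrite ?lef_pV2 ?posrE ?exprn_gt0 ?invr_ge0 ?ler0n //.
by rewrite natr_sum ler_sum.
Qed.

Lemma rho_le1 m : rho R S m <= 1.
Proof.
rewrite /rho -ball_countC natrD; set b := _%:R; set c := _%:R.
have [->|] := eqVneq (b + c) 0; first by rewrite invr0 mulr0.
rewrite neq_lt ltNge addr_ge0 ?ler0n //= => bc.
by rewrite ler_pdivrMr // mul1r lerDl.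
Qed.

Lemma generic_of_vanishing :
  (forall d, 0 < d -> \forall k \near \oo, e k <= d) -> generic R S.
Proof.
move=> e0; apply/cvgrPdist_le => d d_gt0.
(* The recursion [a / 2 + d / 4] of [weighted_sumS] has the fixed point [d / 2], which leaves
   [d / 2] for the transient term. *)
have [N _ eN] := e0 (d / 4) (divr_gt0 d_gt0 (ltr0n _ 4)).
have bound i : weighted_sum (N + i) <= d / 2 + weighted_sum N * 2^-1 ^+ i.
  elim: i => [|i IH]; first by rewrite addn0 expr0 mulr1 lerDr divr_ge0 // ltW.
  rewrite addnS; apply: le_trans (weighted_sumS _) _.
  have := eN (N + i).+1; rewrite /= -addnS leq_addr => /(_ isT).
  by rewrite exprS; lra.
have /cvgrPdist_le : (weighted_sum N * 2^-1 ^+ i) @[i --> \oo] --> 0.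
  rewrite -(mulr0 (weighted_sum N)); apply: cvgMr; apply: cvg_expr.
  by rewrite ger0_norm ?invr_ge0 ?ler0n // invf_lt1 ?ltr1n.
move=> /(_ (d / 2) (divr_gt0 d_gt0 (ltr0n _ 2)))[M _ HM].
exists (N + M)%N => // m /= le_m.
rewrite ger0_norm ?subr_ge0 ?rho_le1 //; apply: le_trans (sub1_rho m) _.
have le_N : (N <= m)%N by apply: leq_trans le_m; exact: leq_addr.
rewrite -(subnKC le_N); apply: le_trans (bound _) _.
have := HM (m - N)%N; rewrite /= leq_subRL // => /(_ le_m).
by rewrite sub0r normrN => /(le_trans (ler_norm _)); lra.
Qed.

Lemma exponential_density (C q : R) : 0 <= q < 1 -> (forall k, e k <= C * q ^+ k) ->
  exists sigma K : R, [/\ 0 <= sigma < 1, 0 < K &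
    forall m : nat, (1 <= m)%N -> 1 - rho R S m <= K * sigma ^+ m].
Proof.
(* The induction needs [K / 2 + C * s <= K * s], which holds for [K = 3 * C + 1] as soon as
   [s >= 3 / 4]. *)
move=> /andP[q_ge0 q_lt1] eC; pose s := Num.max q (3 / 4).
have s_ge : 3 / 4 <= s by rewrite le_max lexx orbT.
have s_lt1 : s < 1 by rewrite gt_max q_lt1; lra.
have C_ge0 : 0 <= C by have := eC 0%N; rewrite expr0 mulr1; apply: le_trans; exact: density_ge0.
exists s, (3 * C + 1); split; first by apply/andP; split=> //; lra.
  by lra.
move=> m _; apply: le_trans (sub1_rho m) _.
have es k : e k <= C * s ^+ k.
  apply: le_trans (eC k) _; apply: ler_wpM2l => //.
  by apply: lerXn2r; rewrite ?nnegrE ?le_max ?q_ge0 ?lexx.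
elim: m => [|m IH].
  rewrite /weighted_sum big_ord1 !expr0 mul1r divr1.
  by have := es 0%N; rewrite expr0; lra.
apply: le_trans (weighted_sumS m) _.
have sm_ge0 : 0 <= s ^+ m by rewrite exprn_ge0 //; lra.
have s34 : 0 <= (s - 3 / 4) * s ^+ m by rewrite mulr_ge0 // subr_ge0.
have := mulr_ge0 C_ge0 s34; have := mulr_ge0 C_ge0 sm_ge0.
have := es m.+1; rewrite exprS; lra.
Qed.

End Density.

(** * The coset graph of the kernel *)

Section Cosets.
Local Open Scope group_scope.
Variables (G : groupType) (P : pred G) (H : subGroupType P).
Variables (Gbar : groupType) (phi : H -> Gbar).
Hypothesis phiM : {morph phi : x y / x * y}.
Hypothesis phi_surj : set_surj setT setT phi.
Variables (n : nat) (r : 'I_n -> G) (idx : G -> 'I_n) (hpart : G -> H).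
Hypothesis hpartE : forall g, g = r (idx g) * val (hpart g).
Hypothesis idxE : forall i (h : H), idx (r i * val h) = i.

(* (b, i) stands for the left coset {r i * h | phi h = b} of ker phi in G. *)
Local Notation V := (Gbar * 'I_n)%type.

Definition kernel_coset (g : G) : V := (phi (hpart g), idx g).

Definition translate (y : G) (v : V) : V :=
  (phi (hpart (y * r v.2)) * v.1, idx (y * r v.2)).

Lemma hpartK i (h : H) : hpart (r i * val h) = h.
Proof.
have := hpartE (r i * val h); rewrite idxE => /mulgI e.
exact/val_inj/esym.
Qed.

(** If [y * r i] has coordinates [j] and [h'], then [y * r i * h = r j * h' * h]. As [kernel_coset]
    is surjective, this equivariance yields the action laws of [translate] from the group laws of
    [G]. *)
Lemma kernel_cosetM y g : kernel_coset (y * g) = translate y (kernel_coset g).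
Proof.
have e : y * g = r (idx (y * r (idx g))) * val (hpart (y * r (idx g)) * hpart g).
  by rewrite gmulfM mulgA -hpartE -mulgA -hpartE.
by rewrite /kernel_coset /translate /= {1 2}e hpartK idxE phiM.
Qed.

Lemma kernel_coset_surj v : exists g, kernel_coset g = v.
Proof.
case: v => b i; have [h _ <-] := phi_surj (I : setT b).
by exists (r i * val h); rewrite /kernel_coset hpartK idxE.
Qed.

Lemma translateM y z v : translate (y * z) v = translate y (translate z v).
Proof. by have [g <-] := kernel_coset_surj v; rewrite -!kernel_cosetM mulgA. Qed.

Lemma translate1 v : translate 1 v = v.
Proof. by have [g <-] := kernel_coset_surj v; rewrite -kernel_cosetM mul1g. Qed.

(** These elements carry slice [i] to slice [j]: with [h = 1] they compare slices, and with [i = j]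
    they realize left multiplication by [phi h] on a copy of [Gbar]. *)
Definition transport i j (h : H) : G := r j * val h * (r i)^-1.

Lemma translate_transport i j h b :
  translate (transport i j h) (b, i) = (phi h * b, j).
Proof. by rewrite /translate /= mulgVK hpartK idxE. Qed.

Lemma transportV i j h : (transport i j h)^-1 = transport j i h^-1.
Proof. by rewrite /transport !invgM invgK gmulfV mulgA. Qed.

Lemma snd_translate_transport i j h v :
  (translate (transport i j h) v).2 = j <-> v.2 = i.
Proof.
split=> [e|]; last first.
  by case: v => b k ki; rewrite (ki : k = i) translate_transport.
rewrite -(translate1 v) -(mulVg (transport i j h)) translateM transportV.
by case: (translate _ v) e => b k kj; rewrite (kj : k = j) translate_transport.
Qed.

(** * From an invariant mean on the cosets to one on the quotient group *)

Section Mean.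
Local Open Scope ring_scope.
Variables (R : realType) (m : set V -> R).
Hypothesis m_mean : mean m.
Hypothesis m_inv : forall y E, m [set v | E (translate y v)] = m E.

Definition slice i : set V := [set v | v.2 = i].

Lemma mean_slice i j : m (slice i) = m (slice j).
Proof.
rewrite -(m_inv (transport i j 1%g) (slice j)); congr m.
by apply/seteqP; split=> v hv; exact/(snd_translate_transport i j 1%g v).
Qed.

(** Finitely many slices of equal mass cover a space of mass 1. *)
Lemma mean_slice_gt0 i : 0 < m (slice i).
Proof.
have [m_ge0 m1 mU] := m_mean; rewrite lt_neqAle m_ge0 andbT eq_sym; apply/eqP => mi0.
have slice0 (s : seq 'I_n) : m [set v | v.2 \in s] = 0.
  elim: s => [|j s IH].
    have := mU set0 set0 (setI0 _); rewrite setU0 => /esym/eqP.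
    by rewrite -subr_eq0 addrK => /eqP m0; rewrite (_ : [set v | _] = set0) //; apply/seteqP; split.
  have [js|js] := boolP (j \in s).
    rewrite -IH; congr m; apply/seteqP; split=> v /=; rewrite inE; last by move=> ->; rewrite orbT.
    by move=> /orP[/eqP ->|].
  rewrite (_ : [set v | _] = slice j `|` [set v | v.2 \in s]); last first.
    by apply/seteqP; split=> v /=; rewrite inE => /predU1P.
  rewrite mU ?IH ?addr0 ?(mean_slice j i) //.
  by apply/seteqP; split=> v // [vj] /=; rewrite (vj : v.2 = j) (negPf js).
have := slice0 (enum 'I_n); rewrite (_ : [set v | _] = setT) ?m1.
  by move/eqP; rewrite oner_eq0.
by apply/seteqP; split=> v //= _; rewrite mem_enum.
Qed.

(** The mean is restricted to slice [i] and normalized; [transport i i h] with [phi h = g] then acts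
    on it as left multiplication by [g]. *)
Lemma invariant_mean_amenable (i : 'I_n) : amenable R Gbar.
Proof.
have [m_ge0 m1 mU] := m_mean; have c_gt0 := mean_slice_gt0 i.
exists (fun A => m [set v | A v.1 /\ v.2 = i] / m (slice i)); split.
- by move=> A; rewrite divr_ge0.
- rewrite (_ : [set v | _] = slice i) ?divff ?gt_eqF //.
  by apply/seteqP; split=> v //= [].
- move=> A B AB; rewrite -mulrDl -mU.
    by congr (m _ / _); apply/seteqP; split=> v /=; tauto.
  apply/seteqP; split=> v //= [[Av _] [Bv _]].
  by have : (A `&` B) v.1 by []; rewrite AB.
- move=> g A; have [h _ hg] := phi_surj (I : setT g).
  congr (_ / _).
  rewrite -(m_inv (transport i i h) [set v | [set g * x | x in A]%g v.1 /\ v.2 = i]); congr m.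
  apply/seteqP; split=> -[b k].
    move=> [[x Ax] + /snd_translate_transport ki]; rewrite (ki : k = i).
    by rewrite translate_transport hg => /mulgI <-.
  move=> [Ab ki]; rewrite (ki : k = i) /mkset translate_transport hg.
  by split=> //; exists b.
Qed.

End Mean.

(** * Words as paths in the coset graph, and Schreier rewriting *)

Section Words.
Variables (A : finType) (pi : A -> G).
Local Notation X := (A + A)%type.

Definition flip (x : X) : X := match x with inl a => inr a | inr a => inl a end.

Lemma flipK : involutive flip.
Proof. by case. Qed.

Lemma letter_value_flip x : letter_value pi (flip x) = (letter_value pi x)^-1.
Proof. by case: x => a //=; rewrite invgK. Qed.

(* Reading a word w from the coset g ker phi leads to w^-1 g ker phi. *)
Definition act (v : V) (x : X) : V := translate (letter_value pi x)^-1 v.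

Lemma act_flipK v x : act (act v x) (flip x) = v.
Proof. by rewrite /act letter_value_flip invgK -translateM mulgV translate1. Qed.

Lemma foldl_act v w : foldl act v w = translate (word_value pi w)^-1 v.
Proof.
elim: w v => [|x w IH] v /=; first by rewrite invg1 translate1.
by rewrite IH invgM translateM.
Qed.

Lemma act_connected : generating pi -> forall u v, exists w, foldl act u w = v.
Proof.
move=> gen u v; have [g <-] := kernel_coset_surj u; have [h <-] := kernel_coset_surj v.
have [w wE] := gen (g * h^-1).
by exists w; rewrite foldl_act wE -kernel_cosetM invgM invgK mulgVK.
Qed.

(** The coordinate 1 is an arbitrary choice: the coset of [H] reached does not depend on the
    coordinate in [Gbar]. *)
Definition next_coset (i : 'I_n) (x : X) : 'I_n := (act (1, i) x).2.

Lemma snd_act v x : (act v x).2 = next_coset v.2 x.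
Proof. by []. Qed.

Lemma next_cosetK i x : next_coset (next_coset i x) (flip x) = i.
Proof. by rewrite -!snd_act act_flipK. Qed.

(** With [j = next_coset i x], this is the image under [phi] of the Schreier generator
    [(r i)^-1 * x * r j] of [H]. *)
Definition schreier (u : 'I_n * X) : Gbar := (act (1, u.1) u.2).1^-1.

Definition rewrite_word := transduce next_coset (fun i x => inl (i, x) : _ + ('I_n * X)).

Lemma fst_foldl_act v w :
  (foldl act v w).1 = (word_value schreier (rewrite_word v.2 w))^-1 * v.1.
Proof.
elim: w v => [|x w IH] v /=; first by rewrite invg1 mul1g.
by rewrite IH invgM /= /schreier /= invgK /act /translate /= mulg1 mulgA.
Qed.

(** A path from [(1, i)] to [(b^-1, i)] spells a word whose rewriting has value [b]. *)
Lemma schreier_generating (i : 'I_n) : generating pi -> generating schreier.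
Proof.
move=> /act_connected conn b; have [w wE] := conn (1, i) (b^-1, i).
exists (rewrite_word i w); apply: invg_inj.
by have := fst_foldl_act (1, i) w; rewrite wE /= mulg1.
Qed.

Definition kernel_cosets_over (b : Gbar) : seq V := [seq (b, i) | i <- enum 'I_n].

Lemma foldl_act_kernel_cosets_over v w :
  (foldl act v w \in kernel_cosets_over v.1) <-> WP schreier (rewrite_word v.2 w).
Proof.
have -> : (foldl act v w \in kernel_cosets_over v.1) = ((foldl act v w).1 == v.1).
  apply/mapP/eqP => [[i _ ->] //|<-].
  by exists (foldl act v w).2; rewrite ?mem_enum -?surjective_pairing.
rewrite fst_foldl_act -[X in _ == X]mul1g (inj_eq (mulIg _)) invg_eq1.
by split=> /eqP.
Qed.

Lemma WP_rewrite_word i w : WP pi w -> WP schreier (rewrite_word i w).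
Proof.
move=> w1; have := fst_foldl_act (1, i) w.
by rewrite foldl_act w1 invg1 translate1 /= mulg1 => /esym/eqP; rewrite invg_eq1 => /eqP.
Qed.

End Words.
End Cosets.

(** * Combining the transducing machine with the density estimates *)

Theorem theoremA (R : realType) (C : complexity_class)
    (G : groupType) (G_fg : finitely_generated G)
    (P : pred G) (H : subGroupType P) (H_index : finite_index H)
    (Gbar : groupType) (phi : H -> Gbar)
    (phiM : {morph phi : x y / (x * y)%g}) (phi_surj : set_surj setT setT phi)
    (Gbar_infinite : infinite_set [set: Gbar])
    (Gbar_WP : word_problem_in C Gbar) :
  word_problem_generically_in R C G /\
  (~ amenable R Gbar -> word_problem_strongly_generically_in R C G).
Proof.
have [n [r [idx [hpart [hpartE idxE]]]]] := coset_coordinates H_index.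
pose i0 := idx 1%g; pose v0 : Gbar * 'I_n := (1%g, i0).
have V_infinite : infinite_set [set: Gbar * 'I_n].
  move=> /(finite_image fst) fin; apply: Gbar_infinite.
  by apply: sub_finite_set fin => b _; exists (b, i0).
suff main (A : finType) (pi : A -> G) : generating pi ->
    exists N : machine (A + A)%type, exists S,
    [/\ has_mode (class_mode C) N, correct N (WP pi), decides_on C N S, generic R S &
      ~ amenable R Gbar -> strongly_generic R S].
  split=> [|Gbar_nonam] A pi gen;
    by have [N [S [Nmode Ncor Ndec gS sS]]] := main A pi gen; exists N; split=> //;
    exists S => //; exact: sS.
move=> gen.
have conn := act_connected phiM phi_surj hpartE idxE gen.
(* Without letters, the connected graph would consist of [v0] alone. *)
have X_gt0 : (0 < #|{: A + A}|)%N.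
  rewrite lt0n; apply/eqP => X0; apply: V_infinite.
  apply: (@sub_finite_set _ _ [set v0]) (finite_set1 v0) => v _.
  have [[|x w] <-] := conn v0 v; first by [].
  by have := card0_eq X0 x; rewrite inE.
have X_ge2 : (2 <= #|{: A + A}|)%N.
  by move: X_gt0; rewrite card_sum; lia.
pose hit := @hitting R _ _ (act phi r idx hpart pi) (kernel_cosets_over n 1%g).
have E_in := Gbar_WP _ _ (schreier_generating phiM phi_surj hpartE idxE i0 gen).
have [N [Nmode Ncor Ndec]] := transduced_complement
  (nxt := next_coset phi r idx hpart pi)
  (prv := fun i x => next_coset phi r idx hpart pi i (flip x))
  (next_cosetK phiM phi_surj hpartE idxE pi) E_in (WP_rewrite_word phiM phi_surj hpartE idxE i0).
exists N, [set w | ~ WP (schreier phi r idx hpart pi) (rewrite_word phi r idx hpart pi i0 w)].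
have invK := @flipK A; have actK := act_flipK phiM phi_surj hpartE idxE pi.
have le_hit k : (#|[pred w : k.-tuple (A + A)%type | `[< ~ [set w | ~ WP
      (schreier phi r idx hpart pi) (rewrite_word phi r idx hpart pi i0 w)] w >]]|%:R <=
    #|{: A + A}|%:R ^+ k * hit k v0)%R.
  rewrite -hitting_count // ler_nat; apply/eq_leq/eq_card => w; rewrite !inE.
  have inT := foldl_act_kernel_cosets_over phi r idx hpart pi v0 w.
  by apply/asboolP/idP => [/contrapT/inT.2|/inT.1 hw /(_ hw)].
have gen_S : generic R [set w | ~ WP (schreier phi r idx hpart pi)
    (rewrite_word phi r idx hpart pi i0 w)].
  apply: generic_of_vanishing X_ge2 le_hit _ => d d_gt0.
  have := hitting_cvg0 actK (kernel_cosets_over n 1%g) X_gt0 V_infinite conn d_gt0.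
  by apply: filterS => k; exact.
split=> // nonam; split=> //.
have [|K [q [q01 hitq]]] :=
  @hitting_exponential R _ _ _ _ invK actK (kernel_cosets_over n 1%g) X_gt0.
  move=> m m_mean m_act; apply: nonam.
  apply: (invariant_mean_amenable phiM phi_surj hpartE idxE m_mean _ i0) => y E.
  (* Letters act through inverses, so the word is chosen to represent [y^-1]; invariance under
     letters then extends to [y] by induction on the word. *)
  have [w wE] := gen y^-1%g; rewrite -[y]invgK -wE.
  elim: w E {wE} => [|x w IH] E /=.
    by congr m; apply/seteqP; split=> v /=; rewrite invg1 (translate1 phiM phi_surj hpartE idxE).
  rewrite -[RHS]IH -[RHS](m_act x); congr m; apply/seteqP; split=> v /=;
    by rewrite invgM (translateM phiM phi_surj hpartE idxE).
exact: (exponential_density X_ge2 le_hit q01 (hitq^~ v0)).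
Qed.
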